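(* For every integer $m\ge1$ the following polynomial identities in two variables $x,y$ over $\mathbb{Q}$ hold: $$\sum_{k=0}^{2m-1}\left(-\frac12\right)^{k+1}\binom{2m+1}{k}\left(x^{2m+1-k}+y^{2m+1-k}\right)(x+y)^k=\frac{m}{2^{2m}}(x+y)^{2m+1},$$ $$\sum_{k=0}^{2m-2}(-1)^k2^{2m-k-1}\binom{2m}{k}\left(x^{2m-k}+y^{2m-k}\right)(x+y)^k=(2m-1)(x+y)^{2m}+(x-y)^{2m}.$$ *)

(* Defs.v *)
From mathcomp Require Import all_boot all_order all_algebra.
From mathcomp Require Export mpoly.

Set Implicit Arguments.
Unset Strict Implicit.
Unset Printing Implicit Defensive.

(* Main.v *)
Require Import Defs.
From mathcomp Require Import all_boot all_order all_algebra.
From mathcomp Require Import mpoly ring.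

Set Implicit Arguments.
Unset Strict Implicit.
Unset Printing Implicit Defensive.

Import Order.TTheory GRing.Theory Num.Theory.
Local Open Scope ring_scope.

(** Both sums are truncations of the binomial expansion of
    [(x - s / 2)^n + (y - s / 2)^n] with [s = x + y].  Since [x - s / 2] and
    [y - s / 2] are opposite, equal to [+- (x - y) / 2], the full expansion is
    [0] for odd [n] and [2 ((x - y) / 2)^n] for even [n]; the two missing
    terms, [k = n - 1] and [k = n], are multiples of [s^n]. *)

(** Collects all scalars of the binomial theorem into one coefficient, the shape in which the sums
    below can be folded back into powers. *)
Lemma exprDZn (R : comNzRingType) (A : comAlgType R) (c : R) (x s : A) n :
  (x + c *: s) ^+ n
    = \sum_(0 <= k < n.+1) (c ^+ k * 'C(n, k)%:R) *: (x ^+ (n - k) * s ^+ k).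
Proof.
rewrite exprDn big_mkord; apply: eq_bigr => i _.
by rewrite exprZn -scalerAr mulrC -scalerA scaler_nat scalerMnr mulrC.
Qed.

Lemma sum_half_binomial (F : numFieldType) (A : comAlgType F) (x y : A) n :
  \sum_(0 <= k < n.+1) ((- (1 / 2%:R)) ^+ k * 'C(n, k)%:R : F) *:
     ((x ^+ (n - k) + y ^+ (n - k)) * (x + y) ^+ k)
    = ((1 + (- 1) ^+ n) / 2%:R ^+ n) *: (x - y) ^+ n.
Proof.
have halfD (u : A) : u = 2%:R^-1 *: u + 2%:R^-1 *: u.
  by rewrite -scalerDl -mulr2n -[_ *+ 2]mulr_natl divff ?pnatr_eq0 ?scale1r.
have Ex (u v : A) : u + (- (1 / 2%:R)) *: (u + v) = 2%:R^-1 *: (u - v).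
  rewrite {1}[u]halfD mul1r scaleNr scalerDr scalerBr opprD addrA.
  by congr (_ + _); rewrite addrK.
under eq_bigr do rewrite mulrDl scalerDr.
(* The two sums fold into the [n]-th powers of [(x - y) / 2] and [(y - x) / 2]; the sign of the
   second yields [(- 1) ^+ n]. *)
rewrite big_split /= -!exprDZn Ex [x + y]addrC Ex -[y - x]opprB.
rewrite -[- (x - y)]scaleN1r !exprZn scalerA -scalerDl exprVn.
by rewrite mulrDl mul1r mulrC.
Qed.

Lemma sum_half_binomial_trunc (F : numFieldType) (A : comAlgType F) (x y : A)
    n :
  \sum_(0 <= k < n) ((- (1 / 2%:R)) ^+ k * 'C(n.+1, k)%:R : F) *:
     ((x ^+ (n.+1 - k) + y ^+ (n.+1 - k)) * (x + y) ^+ k)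
    = ((1 + (- 1) ^+ n.+1) / 2%:R ^+ n.+1) *: (x - y) ^+ n.+1
      - ((- 1) ^+ n * n%:R / 2%:R ^+ n) *: (x + y) ^+ n.+1.
Proof.
rewrite -sum_half_binomial !big_nat_recr //= binn subnn binSn subSnn !expr1.
rewrite !expr0 -exprS mulrDl !mul1r -mulr2n -scaler_nat scalerA.
rewrite -scaleNr -!addrA -!scalerDl.
(* With [s = x + y], the term [k = n] is [(-1/2)^n (n + 1) s^(n+1)] and the term [k = n + 1] is
   [2 (-1/2)^(n+1) s^(n+1)]; they add up to [(-1/2)^n n s^(n+1)], so [c] vanishes. *)
set c := (X in X *: _); suff -> : c = 0 by rewrite scale0r addr0.
rewrite /c mulr1 !exprS [(- 2%:R^-1) ^+ n]exprNn exprVn -[n.+1]addn1 natrD.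
have n2 : (2%:R : F) != 0 by rewrite pnatr_eq0.
have np : (2%:R : F) ^+ n != 0 by rewrite expf_neq0.
by field.
Qed.

(** Truncated sum at [n = 2 * m], times [-1/2]: the power of [x - y] has coefficient [1 - 1 = 0],
    and [2m / 2] leaves [m]. *)
Lemma sum_half_binomial_odd (F : numFieldType) (A : comAlgType F) (x y : A) m :
  \sum_(0 <= k < 2 * m)
     ((- (1 / 2%:R)) ^+ k.+1 * 'C((2 * m).+1, k)%:R : F) *:
       ((x ^+ ((2 * m).+1 - k) + y ^+ ((2 * m).+1 - k)) * (x + y) ^+ k)
    = (m%:R / 2%:R ^+ (2 * m)) *: (x + y) ^+ (2 * m).+1.
Proof.
under eq_bigr do rewrite exprS -mulrA -scalerA.
have sgn : (- 1) ^+ (2 * m) = 1 :> F by rewrite exprM sqrrN !expr1n.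
rewrite -scaler_sumr sum_half_binomial_trunc [(- 1) ^+ _.+1]exprS sgn mulr1.
rewrite subrr mul0r scale0r sub0r scalerN scalerA -scaleNr natrM.
congr (_ *: _).
have n2 : (2%:R : F) != 0 by rewrite pnatr_eq0.
have np : (2%:R : F) ^+ (2 * m) != 0 by rewrite expf_neq0.
by field.
Qed.

Lemma sum_half_binomial_even (F : numFieldType) (A : comAlgType F) (x y : A) m :
  (0 < m)%N ->
  \sum_(0 <= k < 2 * m - 1)
     ((- 1) ^+ k * 2%:R ^+ (2 * m - k - 1) * 'C(2 * m, k)%:R : F) *:
       ((x ^+ (2 * m - k) + y ^+ (2 * m - k)) * (x + y) ^+ k)
    = (2 * m - 1)%:R *: (x + y) ^+ (2 * m) + (x - y) ^+ (2 * m).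
Proof.
move=> m_gt0.
have sgn : (- 1) ^+ (2 * m) = 1 :> F by rewrite exprM sqrrN !expr1n.
(* Positivity of [m] provides the predecessor [n = 2m - 1], which is odd. *)
have [n En] : exists n, (2 * m = n.+1)%N.
  by exists (2 * m).-1; rewrite prednK ?muln_gt0.
rewrite En subn1 /= in sgn *.
have sgn' : (- 1) ^+ n = - 1 :> F.
  by apply: oppr_inj; rewrite -[LHS]mulN1r -exprS sgn opprK.
have n2 : (2%:R : F) != 0 by rewrite pnatr_eq0.
have np : (2%:R : F) ^+ n != 0 by rewrite expf_neq0.
(* Scaling by [2^n] turns [(-1/2)^k] into [(-1)^k 2^(n-k)]. *)
transitivity (2%:R ^+ n *: \sum_(0 <= k < n)
    ((- (1 / 2%:R)) ^+ k * 'C(n.+1, k)%:R : F) *: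
     ((x ^+ (n.+1 - k) + y ^+ (n.+1 - k)) * (x + y) ^+ k)).
  rewrite scaler_sumr; apply: eq_big_nat => k /andP[_ lt_kn].
  rewrite scalerA mulrA; congr (_ * _ *: _).
  rewrite subnAC subn1 /= expfB // mul1r [(- 2%:R^-1) ^+ k]exprNn exprVn.
  by rewrite mulrCA.
rewrite sum_half_binomial_trunc sgn sgn' scalerBr !scalerA addrC -scaleNr.
have -> : - (2%:R ^+ n * (- 1 * n%:R / 2%:R ^+ n)) = n%:R :> F by field.
have -> : 2%:R ^+ n * ((1 + 1) / 2%:R ^+ n.+1) = 1 :> F.
  by rewrite exprS; field.
by rewrite scale1r.
Qed.

Theorem mainTheorem8 (m : nat) (hm : (1 <= m)%N) :
  let x : {mpoly rat[2]} := 'X_(ord0 : 'I_2) in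
  let y : {mpoly rat[2]} := 'X_(ord_max : 'I_2) in
  \sum_(0 <= k < (2 * m)%N)
     ((- (1 / 2%:R)) ^+ k.+1 * 'C((2 * m).+1, k)%:R : rat) *:
       ((x ^+ ((2 * m).+1 - k)%N + y ^+ ((2 * m).+1 - k)%N) * (x + y) ^+ k)
    = (m%:R / 2%:R ^+ (2 * m)%N : rat) *: (x + y) ^+ (2 * m).+1
  /\
  \sum_(0 <= k < (2 * m - 1)%N)
     ((- 1) ^+ k * 2%:R ^+ (2 * m - k - 1)%N * 'C(2 * m, k)%:R : rat) *:
       ((x ^+ (2 * m - k)%N + y ^+ (2 * m - k)%N) * (x + y) ^+ k)
    = ((2 * m - 1)%N%:R : rat) *: (x + y) ^+ (2 * m)%N + (x - y) ^+ (2 * m)%N.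
Proof.
(* Nothing is specific to polynomials: both identities hold in any commutative algebra over a
   numeric field. *)
move=> x y; split; first exact: sum_half_binomial_odd.
exact: sum_half_binomial_even.
Qed.
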